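(* Let $X\in\mathfrak{PO}_{fd}$. Then every copy of $c_0$ in $X$ (that is, every closed linear subspace of $X$ isomorphic to $c_0$) is complemented in $X$.
   Context: All Banach spaces are real; isometric embeddings are always linear. A closed subspace $Y$ of a Banach space $X$ is complemented if there is a bounded linear projection of $X$ onto $Y$. Pushout: given Banach spaces $Z\subseteq F$ and an isometric embedding $j\colon Z\to Y$, the pushout space is $W=(F\oplus_1 Y)/\Delta$, where $F\oplus_1 Y$ carries the $\ell_1$-sum norm and $\Delta=\{(z,-j(z)) : z\in Z\}$, with the canonical maps $F\to W$, $x\mapsto(x,0)+\Delta$, and $Y\to W$, $y\mapsto(0,y)+\Delta$ (both are isometric embeddings); $Y$ is identified with its image in $W$. The class $\mathfrak{PO}_{fd}$ consists of all Banach spaces that can be obtained as the limit (i.e. the completion of the union) of a transfinite chain of Banach spaces $\{X_\alpha\}_{\alpha<\rho}$ such that $X_0$ is separable, $X_\delta=\operatorname{cl}(\bigcup_{\xi<\delta}X_\xi)$ for every limit ordinal $\delta<\rho$, and for each $\alpha$ with $\alpha+1<\rho$ the inclusion $X_\alpha\subseteq X_{\alpha+1}$ is (up to linear isometry) the canonical map of $X_\alpha$ into the pushout space of an inclusion $E_\alpha\subseteq F_\alpha$ of finite-dimensional Banach spaces and an isometric embedding $j_\alpha\colon E_\alpha\to X_\alpha$. *)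

(* Defs.v *)
From HB Require Import structures.
From mathcomp Require Import all_boot all_order all_algebra.
From mathcomp Require Import all_classical all_reals all_analysis.
From mathcomp Require wochoice.

Set Implicit Arguments.
Unset Strict Implicit.
Unset Printing Implicit Defensive.

Import Order.TTheory GRing.Theory Num.Theory.
Import numFieldNormedType.Exports.

Local Open Scope classical_set_scope.
Local Open Scope ring_scope.
Local Open Scope quotient_scope.

Record isometric_embedding (R : realType) (E F : normedModType R) := {
  isometric_embedding_fun :> {linear E -> F} ;
  isometric_embeddingP : forall x, `|isometric_embedding_fun x| = `|x| }.

Arguments isometric_embeddingP {R E F} _ _.

(* The pushout of u : E -> F (playing the role of an inclusion E <= F) and
   j : E -> Y is the quotient of F * Y by the graph
   {(u z, - j z) | z in E}. Beware that the library norm on F * Y is the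
   max norm; the l1-sum norm is used explicitly below. *)
Section Pushout.
Context (R : realType) (E : completeNormedModType R) (F Y : normedModType R).
Variables (u : isometric_embedding E F) (j : isometric_embedding E Y).

Definition po_kernel : {pred (F * Y)%type} :=
  fun p => `[< exists z, p = (u z, - j z) >].

Fact po_kernel_submod_closed : submod_closed po_kernel.
Proof.
split; first by apply/asboolP; exists 0; rewrite [u 0]linear0 [j 0]linear0 oppr0.
move=> a _ _ /asboolP[z ->] /asboolP[t ->]; apply/asboolP; exists (a *: z + t).
by rewrite (linearP u) (linearP j) opprD -scalerN.
Qed.

HB.instance Definition _ :=
  GRing.isSubmodClosed.Build R (F * Y)%type po_kernel po_kernel_submod_closed.

Definition pushout : Type := Quotient.quot po_kernel.

HB.instance Definition _ := GRing.Zmodule.on pushout.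
HB.instance Definition _ := Quotient.on pushout.

Definition po_pi (p : F * Y) : pushout := \pi_(pushout) p.

Lemma po_piE p q : (po_pi p = po_pi q) <-> exists z, p - q = (u z, - j z).
Proof.
rewrite /po_pi; split=> [/eqP|zP].
  by rewrite -Quotient.idealrBE => /asboolP.
by apply/eqP; rewrite -Quotient.idealrBE; apply/asboolP.
Qed.

Lemma po_repr (q : pushout) : po_pi (repr q) = q.
Proof. exact: reprK. Qed.

Lemma po_piD p q : po_pi (p + q) = po_pi p + po_pi q.
Proof. by rewrite /po_pi !piE. Qed.

Definition po_scale (a : R) (q : pushout) : pushout := po_pi (a *: repr q).

Lemma po_piZ a p : po_pi (a *: p) = po_scale a (po_pi p).
Proof.
apply/po_piE; have /po_piE[z hz] := esym (po_repr (po_pi p)).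
by exists (a *: z); rewrite -scalerBr hz (linearZ_LR u) (linearZ_LR j) -scalerN.
Qed.

Fact po_scaleA a b q : po_scale a (po_scale b q) = po_scale (a * b) q.
Proof. by rewrite -(po_repr q) -!po_piZ scalerA. Qed.

Fact po_scale1 : left_id 1 po_scale.
Proof. by move=> q; rewrite -(po_repr q) -!po_piZ scale1r. Qed.

Fact po_scaleDr : right_distributive po_scale +%R.
Proof.
move=> a p q; rewrite -(po_repr p) -(po_repr q).
by rewrite -po_piD -!po_piZ -po_piD scalerDr.
Qed.

Fact po_scaleDl q : {morph po_scale^~ q : a b / a + b}.
Proof. by move=> a b; rewrite -(po_repr q) -!po_piZ -po_piD scalerDl. Qed.

HB.instance Definition _ := GRing.Zmodule_isLmodule.Build R pushout
  po_scaleA po_scale1 po_scaleDr po_scaleDl.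

Fact po_pi_is_linear : linear po_pi.
Proof. by move=> a p q; rewrite po_piD po_piZ. Qed.

HB.instance Definition _ := GRing.isLinear.Build R (F * Y)%type pushout *:%R
  po_pi po_pi_is_linear.

Definition po_norm (q : pushout) : R :=
  inf [set `|p.1| + `|p.2| | p in [set p | po_pi p = q]].

Lemma po_norm_has_inf q :
  has_inf [set `|p.1| + `|p.2| | p in [set p | po_pi p = q]].
Proof.
split; first by exists (`|(repr q).1| + `|(repr q).2|), (repr q) => //=;
  exact: po_repr.
by exists 0 => _ [p _ <-]; rewrite addr_ge0.
Qed.

Lemma po_norm_le p : po_norm (po_pi p) <= `|p.1| + `|p.2|.
Proof. by apply: ge_inf; [case: (po_norm_has_inf (po_pi p))|exists p]. Qed.

Lemma po_norm_adherent q e : 0 < e ->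
  exists2 p, po_pi p = q & `|p.1| + `|p.2| < po_norm q + e.
Proof.
move=> e0; have [_ [p pq <-] pe] := inf_adherent e0 (po_norm_has_inf q).
by exists p.
Qed.

Fact po_ler_normD p q : po_norm (p + q) <= po_norm p + po_norm q.
Proof.
apply/ler_addgt0Pr => e e0.
have e20 : 0 < e / 2 by rewrite divr_gt0.
have [a <- alt] := po_norm_adherent p e20.
have [b <- blt] := po_norm_adherent q e20.
rewrite -po_piD (le_trans (po_norm_le _))//=.
apply: (@le_trans _ _ ((`|a.1| + `|a.2|) + (`|b.1| + `|b.2|))).
  by rewrite addrACA lerD// ler_normD.
by rewrite (le_trans (lerD (ltW alt) (ltW blt)))// addrACA -splitr.
Qed.

Fact po_normrZ (a : R) q : po_norm (a *: q) = `|a| * po_norm q.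
Proof.
have H b r : po_norm (b *: r) <= `|b| * po_norm r.
  have [->|b0] := eqVneq b 0.
    rewrite scale0r normr0 mul0r -(linear0 po_pi).
    by rewrite (le_trans (po_norm_le _))//= !normr0 addr0.
  rewrite -ler_pdivrMl ?normr_gt0//; apply/ler_addgt0Pr => e e0.
  have [p <- plt] := po_norm_adherent r e0.
  rewrite (le_trans _ (ltW plt))// ler_pdivrMl ?normr_gt0//.
  by rewrite -[_ *: po_pi p]po_piZ (le_trans (po_norm_le _))//= !normrZ mulrDr.
apply/eqP; rewrite eq_le H/=.
have [->|a0] := eqVneq a 0.
  by rewrite normr0 mul0r; apply: lb_le_inf => [|_ [p _ <-]];
    [case: (po_norm_has_inf (0 *: q))|rewrite addr_ge0].
rewrite -ler_pdivlMl ?normr_gt0// -normfV (le_trans _ (H _ _))//.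
by rewrite scalerA mulVf// scale1r.
Qed.

Fact po_normr0_eq0 q : po_norm q = 0 -> q = 0.
Proof.
move=> q0.
have /choice[z hz] n : exists z,
    `|(repr q).1 - u z| + `|(repr q).2 + j z| < n.+1%:R^-1.
  have [|p pq] := @po_norm_adherent q n.+1%:R^-1; first by rewrite invr_gt0.
  rewrite q0 add0r; have /po_piE[z] := etrans (po_repr q) (esym pq).
  move=> rpz; suff -> : p = ((repr q).1 - u z, (repr q).2 + j z) by exists z.
  have -> : p = repr q - (repr q - p) by rewrite opprB addrC subrK.
  by rewrite rpz; congr pair => /=; rewrite ?opprK.
have z1 n : `|(repr q).1 - u (z n)| < n.+1%:R^-1.
  by apply: le_lt_trans (hz n); rewrite lerDl.
have z2 n : `|(repr q).2 + j (z n)| < n.+1%:R^-1.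
  by apply: le_lt_trans (hz n); rewrite lerDr.
have inv_near (e : R) : 0 < e -> \forall n \near \oo, n.+1%:R^-1 < e.
  by move=> e0; exact: near_infty_natSinv_lt (PosNum e0).
have zcauchy : cauchy (z @ \oo).
  apply: cauchy_exP => e e0; have e20 : 0 < e / 2 by rewrite divr_gt0.
  have [N _ HN] := inv_near _ e20.
  exists (z N); exists N => // n /= Nn; rewrite -ball_normE/=.
  rewrite -(isometric_embeddingP u) linearB/=.
  rewrite (le_lt_trans (ler_distD (repr q).1 _ _))// [ltRHS]splitr.
  by rewrite ltrD// 1?[`|u _ - _|]distrC (lt_trans (z1 _))//; apply: HN => /=.
have /cauchy_cvg/cvg_ex[/= l zl] := zcauchy.
have zn (e : R) : 0 < e -> \forall n \near \oo, `|l - z n| < e.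
  by move=> e0; move/cvgrPdist_lt: zl; apply.
have ul : u l = (repr q).1.
  apply/eqP; rewrite eq_sym -subr_eq0 -normr_le0; apply/ler_addgt0Pr => e e0.
  have e20 : 0 < e / 2 by rewrite divr_gt0.
  have [n [n1 n2]] := @filter_ex _ _ _ _
    (filterI (inv_near _ e20) (zn _ e20)).
  rewrite add0r -[_.1](subrK (u (z n))) -addrA -linearB.
  rewrite (le_trans (ler_normD _ _))// isometric_embeddingP [leRHS]splitr.
  by rewrite lerD// ltW// ?(lt_trans (z1 n))// distrC.
have jl : - j l = (repr q).2.
  apply/eqP; rewrite eq_sym -subr_eq0 opprK -normr_le0.
  apply/ler_addgt0Pr => e e0.
  have e20 : 0 < e / 2 by rewrite divr_gt0.
  have [n [n1 n2]] := @filter_ex _ _ _ _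
    (filterI (inv_near _ e20) (zn _ e20)).
  rewrite add0r -[_.2](addrK (j (z n))) -addrA [- _ + _]addrC -linearB.
  rewrite (le_trans (ler_normD _ _))// isometric_embeddingP [leRHS]splitr.
  by rewrite lerD// ltW// (lt_trans (z2 n)).
rewrite -(po_repr q) -(linear0 po_pi); apply/po_piE; exists l.
by rewrite subr0 ul jl; case: (repr q).
Qed.

HB.instance Definition _ := Lmodule_isNormed.Build R pushout
  po_ler_normD po_normrZ po_normr0_eq0.

Definition po_inr (y : Y) : pushout := po_pi (0, y).

End Pushout.

Section C0.
Context (R : realType).

Definition null_sequence : {pred (nat -> R)} :=
  fun x => `[< x n @[n --> \oo] --> (0 : R) >].

Record c0 := C0 { c0_val :> nat -> R ; c0_valP : c0_val \in null_sequence }.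

HB.instance Definition _ := [isSub for c0_val].
HB.instance Definition _ := [Choice of c0 by <:].

Fact null_sequence_submod_closed : submod_closed null_sequence.
Proof.
split; first by apply/asboolP; exact: cvg_cst.
move=> a x y /asboolP x0 /asboolP y0; apply/asboolP.
rewrite -[X in _ --> X]addr0 -[X in _ --> X + _](mulr0 a).
by apply: cvgD => //; exact: cvgMr.
Qed.

HB.instance Definition _ :=
  GRing.isSubmodClosed.Build R (nat -> R) null_sequence
    null_sequence_submod_closed.
HB.instance Definition _ := [SubChoice_isSubLmodule of c0 by <:].

Definition c0_norm (x : c0) : R := sup (range (fun n => `|x n|)).

Lemma c0_norm_has_sup (x : c0) : has_sup (range (fun n => `|x n|)).
Proof.
split; first by exists `|x 0%N|, 0%N.
apply: bounded_fun_has_ubound; apply: cvg_seq_bounded.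
by apply/cvg_ex; exists `|0 : R|; apply: cvg_norm; apply/asboolP/(c0_valP x).
Qed.

Lemma c0_norm_ge (x : c0) n : `|x n| <= c0_norm x.
Proof. by apply: sup_upper_bound; [exact: c0_norm_has_sup|exists n]. Qed.

Lemma c0_norm_le (x : c0) (b : R) : (forall n, `|x n| <= b) -> c0_norm x <= b.
Proof.
by move=> xb; apply: ge_sup => [|_ [n _ <-]//]; exists `|x 0%N|, 0%N.
Qed.

Fact c0_ler_normD x y : c0_norm (x + y) <= c0_norm x + c0_norm y.
Proof.
apply: c0_norm_le => n; rewrite (le_trans (ler_normD _ _))//.
by rewrite lerD// c0_norm_ge.
Qed.

Fact c0_normrZ (a : R) x : c0_norm (a *: x) = `|a| * c0_norm x.
Proof.
apply/eqP; rewrite eq_le; apply/andP; split.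
  by apply: c0_norm_le => n; rewrite normrM ler_wpM2l// c0_norm_ge.
have [->|a0] := eqVneq a 0.
  by rewrite normr0 mul0r (le_trans _ (c0_norm_ge _ 0%N)).
rewrite -ler_pdivlMl ?normr_gt0//; apply: c0_norm_le => n.
rewrite ler_pdivlMl ?normr_gt0// -normrM.
exact: (c0_norm_ge (a *: x)).
Qed.

Fact c0_normr0_eq0 x : c0_norm x = 0 -> x = 0.
Proof.
move=> x0; apply/val_inj/funext => n; apply/eqP.
by rewrite -normr_le0 -x0 c0_norm_ge.
Qed.

HB.instance Definition _ := Lmodule_isNormed.Build R c0
  c0_ler_normD c0_normrZ c0_normr0_eq0.

End C0.

Arguments c0 : clear implicits.

Definition separable (T : topologicalType) :=
  exists2 A : set T, countable A & dense A.

Definition finite_dimensional (R : realType) (E : lmodType R) :=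
  exists n, inhabited (Vector.axiom n E).

Definition linear_subspace (R : realType) (V : lmodType R) (Z : set V) :=
  Z 0 /\ forall (a : R) x y, Z x -> Z y -> Z (a *: x + y).

(* Z, with the norm of X, is linearly homeomorphic to V *)
Definition isomorphic_to (R : realType) (X : normedModType R) (Z : set X)
    (V : normedModType R) :=
  exists (f : {linear V -> X}) (g : X -> V),
    [/\ continuous f, {within Z, continuous g}, cancel f g & range f = Z].

Definition complemented (R : realType) (X : normedModType R) (Z : set X) :=
  exists P : {linear X -> X},
    [/\ exists M : R, forall x, `|P x| <= M * `|x|,
        forall x, P (P x) = P x & range P = Z].

(* Ordinals < rho are the elements of a well-ordered type I. *)
Section Ordinals.
Context (d : Order.disp_t) (I : orderType d).

Definition is_first (a : I) := forall b, (a <= b)%O.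

Definition is_succ (a b : I) := (a < b)%O /\ forall c, (a < c)%O -> (b <= c)%O.

Definition is_limit (a : I) := ~ is_first a /\ ~ exists b, is_succ b a.

End Ordinals.

(* i : Y -> Y' is, up to a linear isometry, the canonical map of Y into the
   pushout of an inclusion of finite-dimensional spaces and an isometric
   embedding of the smaller one into Y. *)
Definition fd_pushout_map (R : realType) (Y Y' : normedModType R)
    (i : Y -> Y') :=
  exists (E F : completeNormedModType R) (u : isometric_embedding E F)
    (j : isometric_embedding E Y) (T : isometric_embedding (pushout u j) Y'),
    [/\ finite_dimensional E, finite_dimensional F, range T = setT &
        forall y, T (po_inr u j y) = i y].

(* The members of the chain are Banach spaces Xs a, embedded isometrically in
   X by e a; the inclusion of Xs a in Xs b is the map i with e b \o i = e a.
   The last condition forces I to be nonempty. *)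
Definition PO_fd (R : realType) (X : completeNormedModType R) :=
  exists (d : Order.disp_t) (I : orderType d)
    (Xs : I -> completeNormedModType R)
    (e : forall a, isometric_embedding (Xs a) X),
    [/\ wochoice.well_order (<=%O : rel I) /\
        (forall a b, (a <= b)%O -> range (e a) `<=` range (e b)),
        forall a, is_first a -> separable (Xs a),
        forall a, is_limit a ->
          range (e a) = closure (\bigcup_(b in [set b | (b < a)%O]) range (e b)),
        forall a b, is_succ a b ->
          exists2 i : Xs a -> Xs b, e b \o i =1 e a & fd_pushout_map i &
        closure (\bigcup_a range (e a)) = setT].

(* Main.v *)
From HB Require Import structures.
Require Import Defs.
From mathcomp Require Import all_boot all_order all_algebra.
From mathcomp Require Import all_classical all_reals all_analysis.
From mathcomp Require wochoice.
From mathcomp Require Import ring lra.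
Import Order.TTheory GRing.Theory Num.Theory.
Import numFieldNormedType.Exports.

Set Implicit Arguments.
Unset Strict Implicit.
Unset Printing Implicit Defensive.

Local Open Scope classical_set_scope.
Local Open Scope ring_scope.

(** A bounded operator from a normed space to c_0 is a uniformly bounded
   sequence of functionals that tends to 0 at every point. The whole argument
   is run with such sequences. It shows that X has the following extension
   property: a c_0-valued operator given on a separable subspace of X extends
   to X, with at most twice the norm ([c0_valued_extension]). If f is an
   isomorphism of c_0 onto Z, then extending the inverse of f from Z to an
   operator Phi on X makes f \o Phi a bounded projection of X onto Z.

   The extension property rests on three facts.

   - Sobczyk's theorem ([sobczyk], by Veech's proof): the extension is possible
     from a subspace to a separable superspace, at the price of a factor 2.

   - Norm-null extension over a pushout of finite-dimensional spaces. If
     functionals phi_n on Y tend to 0 pointwise, then they tend to 0 in norm on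
     the finite-dimensional space j(E); so norm-preserving extensions from E to
     F (Hahn-Banach) tend to 0 as well. Because the pushout carries the quotient
     of an l1-norm, phi_n on Y and the extension on F together define a
     functional of norm at most the larger of the two norms. So an operator from
     Y to c_0 extends to the pushout, and transfinite induction along the chain
     never increases the norm.

   - A support argument, which combines the two. The separable subspace of X on
     which Sobczyk's theorem is used has to be visited by the chain in a coherent
     way. Each point of X depends on only countably many steps of the chain
     ([determines_closure], [determines_countable]), and so does the
     finite-dimensional space E of each step. Hence some countable set S of steps
     contains the support of the given separable space and, with each of its
     steps b, the support of E_b ([support_closure]). Sobczyk's theorem provides
     psi_n with the right values on the separable space built from the steps in
     S. Then phi_n is defined along the chain: at a step in S the values on F are
     those of psi_n, at any other step they are the chosen norm-preserving
     extension ([follows]). At a step in S the two prescriptions agree on E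
     because the support of E lies in S, below the step ([follows_exists]). The
     second fact then gives phi_n -> 0 everywhere ([follows_null]).

   Limits of the chain need no construction of their own: the functionals already
   built on the members below glue, because they are uniquely determined
   ([follows_uniq]), and they are then extended to X by Hahn-Banach. *)

(** * Bounded functionals and the Hahn-Banach theorem *)

Section BoundedFunctional.
Context (R : realType) (X : normedModType R).
Implicit Types (C : R) (f g : X -> R) (G H : set (X * R)).

(** A predicate on bare functions, rather than a type of continuous linear maps:
   functionals are cut, glued and chosen pointwise all along, and the bound is
   what has to be tracked. *)
Definition bounded_functional C f :=
  (forall (a : R) x y, f (a *: x + y) = a * f x + f y) /\
  forall x, `|f x| <= C * `|x|.

Lemma bfun_lin C f (a : R) x y : bounded_functional C f ->
  f (a *: x + y) = a * f x + f y.
Proof. by case. Qed.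

Lemma bfun_le C f x : bounded_functional C f -> `|f x| <= C * `|x|.
Proof. by case. Qed.

Lemma bfunD C f x y : bounded_functional C f -> f (x + y) = f x + f y.
Proof. by move=> [fl _]; rewrite -[x]scale1r fl mul1r scale1r. Qed.

Lemma bfun0 C f : bounded_functional C f -> f 0 = 0.
Proof. by move=> hf; have := bfunD 0 0 hf; rewrite addr0 => ?; lra. Qed.

Lemma bfunZ C f (a : R) x : bounded_functional C f -> f (a *: x) = a * f x.
Proof.
by move=> hf; rewrite -[a *: x]addr0 (bfun_lin _ _ _ hf) (bfun0 hf) addr0.
Qed.

Lemma bfunB C f x y : bounded_functional C f -> f (x - y) = f x - f y.
Proof.
by move=> hf; rewrite -scaleN1r addrC (bfun_lin _ _ _ hf) mulN1r addrC.
Qed.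

Lemma bfun_sum C f n (c : 'I_n -> R) (v : 'I_n -> X) : bounded_functional C f ->
  f (\sum_i c i *: v i) = \sum_i c i * f (v i).
Proof.
move=> hf; elim/big_ind2 : _ => [|x r y s <- <-|i _].
- exact: bfun0 hf.
- exact: bfunD hf.
- exact: bfunZ hf.
Qed.

Lemma bfun_sub C D f g : bounded_functional C f -> bounded_functional D g ->
  bounded_functional (C + D) (fun x => f x - g x).
Proof.
move=> [fl fb] [gl gb]; split=> [a x y|x]; first by rewrite fl gl; ring.
by rewrite mulrDl (le_trans (ler_normB _ _))// lerD.
Qed.

(** A functional on a subspace of X is handled as its graph. The bound makes the
   relation single-valued, since it forces r = 0 whenever (0, r) belongs to it,
   so no domain has to be named and unions of chains are immediate. *)
Definition bounded_graph C G :=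
  (forall (a : R) x r y s, G (x, r) -> G (y, s) -> G (a *: x + y, a * r + s)) /\
  forall x r, G (x, r) -> `|r| <= C * `|x|.

(** The classical one-dimensional step: by the triangle inequality each lower
   constraint on the value at x is below each upper one, so the supremum of the
   lower ones satisfies all of them. *)
Lemma bounded_graph_extend1 C G x : 0 <= C -> bounded_graph C G -> G !=set0 ->
  exists H, [/\ bounded_graph C H, G `<=` H & exists r, H (x, r)].
Proof.
move=> C0 [Glin Gb] [[x0 r0] G0].
have G00 : G (0, 0).
  have := Glin (-1) _ _ _ _ G0 G0.
  by rewrite scaleN1r mulN1r !addNr.
have GZ a y s : G (y, s) -> G (a *: y, a * s).
  by move=> Gy; have := Glin a _ _ _ _ Gy G00; rewrite !addr0.
pose A := [set - (C * `|p.1 + x|) - p.2 | p in G].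
have key p q : G p -> G q -> - (C * `|p.1 + x|) - p.2 <= C * `|q.1 + x| - q.2.
  case: p q => [y s] [y' s'] Gy Gy' /=.
  have /Gb := Glin (-1) _ _ _ _ Gy Gy'.
  rewrite mulN1r scaleN1r => h.
  have : `|- s + s'| <= C * (`|y + x| + `|y' + x|).
    apply: (le_trans h); apply: ler_wpM2l => //.
    have -> : - y + y' = (y' + x) - (y + x).
      by rewrite opprD addrACA subrr addr0 addrC.
    by rewrite (le_trans (ler_normB _ _))// addrC.
  by rewrite ler_norml => /andP[]; lra.
have Asup : has_sup A.
  split; first by exists (- (C * `|x0 + x|) - r0), (x0, r0).
  by exists (C * `|x0 + x| - r0) => _ [p Gp <-]; exact: (key p (x0, r0)).
pose r := sup A.
have rb y s : G (y, s) -> `|s + r| <= C * `|y + x|.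
  move=> Gy; rewrite ler_norml; apply/andP; split.
    by rewrite -lerBlDl; apply: sup_upper_bound => //; exists (y, s).
  rewrite -lerBrDl; apply: ge_sup => [|_ [p Gp <-]]; first by case: Asup.
  exact: (key p (y, s)).
exists [set q | exists y s t, G (y, s) /\ q = (y + t *: x, s + t * r)].
split.
- split=> [a _ _ _ _ [y [s [t [Gy [-> ->]]]]] [y' [s' [t' [Gy' [-> ->]]]]]|].
    exists (a *: y + y'), (a * s + s'), (a * t + t'); split; first exact: Glin.
    congr pair; last by ring.
    by rewrite scalerDr scalerDl addrACA scalerA.
  move=> _ _ [y [s [t [Gy [-> ->]]]]].
  have [->|t0] := eqVneq t 0.
    by rewrite scale0r mul0r !addr0; exact: Gb.
  have := rb _ _ (GZ t^-1 _ _ Gy).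
  rewrite -(ler_pM2l (x := `|t|)) ?normr_gt0// -normrM mulrDr mulVKf//.
  by rewrite mulrCA -normrZ scalerDr scalerA mulfV// scale1r.
- by move=> [y s] Gy; exists y, s, 0; rewrite scale0r mul0r !addr0.
- by exists r, 0, 0, 1; rewrite scale1r mul1r !add0r.
Qed.

(** A maximal bounded graph containing G has full domain, by the one-dimensional
   step. In the invariant P the inclusion of G is required of nonempty graphs
   only, because Zorn's lemma also asks about the union of the empty chain. *)
Lemma hahn_banach C G : 0 <= C -> bounded_graph C G ->
  exists2 f, bounded_functional C f & forall x r, G (x, r) -> f x = r.
Proof.
move=> C0 Gok.
have [G0|Gn0] := pselect (G !=set0); last first.
  exists (fun=> 0); first split=> *; rewrite ?mulr0 ?addr0 ?normr0//.
    by rewrite mulr_ge0.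
  by move=> x r Gxr; exfalso; apply: Gn0; exists (x, r).
pose P H := bounded_graph C H /\ (H !=set0 -> G `<=` H).
have [|M [[Mok MG] Mmax]] := @Zorn_bigcup _ P.
  move=> F FP Ftot; split; last first.
    move=> [p [H FH Hp]]; have [_ /(_ _)GH] := FP _ FH.
    by move=> q Gq; exists H => //; apply: GH => //; exists p.
  split=> [a x r y s [H FH Hx] [K FK Ky]|x r [H FH Hx]]; last first.
    by have [[_ /(_ _ _ Hx)]] := FP _ FH.
  have [HK|KH] := Ftot _ _ FH FK.
    by exists K => //; have [[Kl _] _] := FP _ FK; apply: Kl => //; exact: HK.
  by exists H => //; have [[Hl _] _] := FP _ FH; apply: Hl => //; exact: KH.
have M0 : M !=set0.
  apply: contrapT => M0; apply: (Mmax G);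
    last by split=> // _; exact: subset_refl.
  split=> [p Mp|GM]; first by exfalso; apply: M0; exists p.
  by case: G0 => p Gp; apply: M0; exists p; exact: (GM p Gp).
have {}MG := MG M0.
have Mtot x : exists r, M (x, r).
  have [H [Hok MH [r Hr]]] := bounded_graph_extend1 x C0 Mok M0.
  apply: contrapT => Mx; apply: (Mmax H).
    by split=> // /(_ _ Hr) Mr; apply: Mx; exists r.
  by split=> // _; exact: subset_trans MH.
have [f Mf] := choice Mtot.
have Muniq x r s : M (x, r) -> M (x, s) -> r = s.
  have [Ml Mb] := Mok; move=> Mr Ms; have /Mb := Ml (-1) _ _ _ _ Mr Ms.
  rewrite scaleN1r addNr normr0 mulr0 normr_le0 mulN1r addrC subr_eq0.
  by move=> /eqP.
have [Ml Mb] := Mok.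
exists f; first split=> [a x y|x]; last 2 first.
- exact: Mb.
- by move=> x r /MG; exact: Muniq.
by apply: Muniq (Mf _) _; exact: Ml.
Qed.

End BoundedFunctional.

(** * Pointwise null sequences and finite-dimensional spaces *)

Section Nullity.
Context (R : realType) (X : normedModType R).
Implicit Types (A : set X) (phi : nat -> X -> R).

Lemma closure_approx A (x : X) (e : R) : closure A x -> 0 < e ->
  exists2 y, A y & `|x - y| < e.
Proof.
move=> /(_ _ (nbhsx_ballx x e _))xA e0; have [y []] := xA e0.
by rewrite -ball_normE => Ay xy; exists y.
Qed.

(** A uniformly bounded sequence is equicontinuous, so pointwise convergence to 0
   passes to closures. *)
Lemma bfun_null_closure C phi A x : 0 <= C ->
  (forall n, bounded_functional C (phi n)) ->
  (forall y, A y -> phi n y @[n --> \oo] --> (0 : R)) ->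
  closure A x -> phi n x @[n --> \oo] --> (0 : R).
Proof.
move=> C0 hphi hA Ax; apply/cvgr0Pnorm_lt => e e0.
have d0 : 0 < e / (2 * (C + 1)) by rewrite divr_gt0// mulr_gt0// ltr_wpDl.
have [y Ay xy] := closure_approx Ax d0.
have e20 : 0 < e / 2 by rewrite divr_gt0.
have /cvgr0Pnorm_lt/(_ _ e20) := hA _ Ay.
apply: filterS => n phiy.
rewrite -[x](subrK y) (bfunD _ _ (hphi n)) (le_lt_trans (ler_normD _ _))//.
rewrite [ltRHS]splitr ler_ltD// (le_trans (bfun_le _ (hphi n)))//.
apply: (@le_trans _ _ ((C + 1) * (e / (2 * (C + 1))))).
  by rewrite ler_pM// ?lerDl// ltW.
rewrite le_eqVlt; apply/orP; left; apply/eqP; field.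
by rewrite gt_eqF// ltr_wpDl.
Qed.

Lemma bfun_eq_closure C f g A x : 0 <= C ->
  bounded_functional C f -> bounded_functional C g ->
  (forall y, A y -> f y = g y) -> closure A x -> f x = g x.
Proof.
move=> C0 hf hg fg Ax; apply/eqP; rewrite -subr_eq0; apply/eqP.
have CC : 0 <= C + C by rewrite addr_ge0.
have h : (fun _ : nat => f x - g x) n @[n --> \oo] --> (0 : R).
  apply: (bfun_null_closure CC (fun=> bfun_sub hf hg) _ Ax) => y Ay.
  by rewrite (fg y Ay) subrr; exact: cvg_cst.
by rewrite -(cvg_lim (@Rhausdorff R) h) lim_cst.
Qed.

End Nullity.

Section FiniteDimension.
Context (R : realType) (E : normedModType R).

(** All norms on a finite-dimensional space are equivalent: the norm of z attains
   a positive minimum over the compact unit sphere of the coordinate space, and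
   its inverse bounds the coordinates. This is the only form in which
   finite-dimensionality is used. *)
Lemma fd_basis : finite_dimensional E ->
  exists n (b : 'I_n -> E) (M : R), 0 <= M /\
    forall z, exists2 c : 'I_n -> R, z = \sum_i c i *: b i &
      forall i, `|c i| <= M * `|z|.
Proof.
case=> n [[v2r v2rlin [r2v v2rK r2vK]]].
pose b (i : 'I_n) := r2v (delta_mx 0 i).
pose T (c : 'rV[R]_n) := \sum_i c 0 i *: b i.
have v2rD x y : v2r (x + y) = v2r x + v2r y.
  by rewrite -[x in LHS]scale1r v2rlin scale1r.
have v2r0 : v2r 0 = 0.
  by have := v2rD 0 0; rewrite addr0 => /esym/eqP; rewrite -subr_eq0 addrK => /eqP.
have v2rZ a x : v2r (a *: x) = a *: v2r x.
  by rewrite -[a *: x]addr0 v2rlin v2r0 addr0.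
have TE z : z = T (v2r z).
  apply: (can_inj v2rK); rewrite /T.
  rewrite (big_morph v2r v2rD v2r0) [LHS]row_sum_delta.
  by apply: eq_bigr => i _; rewrite v2rZ r2vK.
have Tcont : continuous (fun c => `|T c|).
  suff Tc : continuous T by move=> c; exact: (cvg_norm (Tc c)).
  apply: (@continuous_big E 'I_n +%R 0 xpredT _ 'rV[R]_n (index_enum _)
    (fun i c => c 0 i *: b i)) => [|i _ c]; first exact: add_continuous.
  exact: (cvgZr_tmp (F := nbhs c) (@coord_continuous R 1 n 0 i c)).
pose S := [set c : 'rV[R]_n | `|c| = 1].
(* The sphere is empty exactly in dimension 0. *)
have [S0|nS0] := pselect (S !=set0); last first.
  exists n, b, 0; split=> // z; exists (fun i => v2r z 0 i); first exact: TE.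
  move=> i; suff -> : v2r z = 0 by rewrite mxE normr0 mul0r.
  apply: contrapT => /eqP z0; apply: nS0; exists (`|v2r z|^-1 *: v2r z) => /=.
  by rewrite /S/= normrZ normfV normr_id mulVf// normr_eq0.
have Scomp : compact S.
  apply: bounded_closed_compact.
    by exists 1; split=> // M /ltW M1 c /= ->.
  have -> : S = (fun c : 'rV[R]_n => `|c|) @^-1` [set 1] by [].
  apply: preimage_closed; last exact: closed_eq.
  by move=> c _; exact: norm_continuous.
have [c0 /set_mem c0S c0min] := @EVT_min_rV R n _ S S0 Scomp
   (continuous_subspaceT Tcont).
have T0 : T 0 = 0 by rewrite /T big1// => i _; rewrite mxE scale0r.
have rE c : v2r (T c) = c.
  rewrite /T (big_morph v2r v2rD v2r0) [RHS]row_sum_delta.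
  by apply: eq_bigr => i _; rewrite v2rZ r2vK.
have m0 : 0 < `|T c0|.
  rewrite normr_gt0; apply/eqP => Tc0; have := rE c0; rewrite Tc0 v2r0 => c00.
  by move: c0S; rewrite /S/= -c00 normr0 => /esym/eqP; rewrite oner_eq0.
exists n, b, `|T c0|^-1; split=> [|z]; first by rewrite invr_ge0.
exists (fun i => v2r z 0 i) => [|i]; first exact: TE.
have -> : z = T (v2r z) by exact: TE.
rewrite rE; set c := v2r z.
have ci : `|c 0 i| <= `|c|.
  by rewrite [leRHS]/Num.norm/= mx_normrE; apply/bigmax_geP; right; exists (0, i).
apply: (le_trans ci); rewrite ler_pdivlMl//.
have [->|cn0] := eqVneq c 0; first by rewrite normr0 mulr0.
have cS : `|c|^-1 *: c \in S.
  by apply/mem_set; rewrite /S/= normrZ normfV normr_id mulVf// normr_eq0.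
have TZ a : T (a *: c) = a *: T c.
  by rewrite /T scaler_sumr; apply: eq_bigr => j _; rewrite mxE scalerA.
have := c0min _ cS; rewrite TZ normrZ normfV normr_id.
by rewrite ler_pdivlMl ?normr_gt0// mulrC.
Qed.

(** On a finite-dimensional space pointwise convergence to 0 is convergence in
   norm, as it suffices to control the values on a basis. *)
Lemma fd_uniform_null C (phi : nat -> E -> R) : finite_dimensional E ->
  (forall n, bounded_functional C (phi n)) ->
  (forall z, phi n z @[n --> \oo] --> (0 : R)) ->
  forall e, 0 < e -> \forall n \near \oo, forall z, `|phi n z| <= e * `|z|.
Proof.
move=> /fd_basis[m [b [M [M0 bM]]]] hphi phi0 e e0.
pose D := m.+1%:R * (M + 1).
have D0 : 0 < D by rewrite mulr_gt0// ltr_wpDl.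
have d0 : 0 < e / D by rewrite divr_gt0.
have H : \forall n \near \oo, forall i, `|phi n (b i)| < e / D.
  by apply: filter_forall => i; have /cvgr0Pnorm_lt/(_ _ d0) := phi0 (b i).
apply: filterS H => n Hn z.
have [c zE cM] := bM z.
have -> : phi n z = \sum_i c i * phi n (b i) by rewrite zE (bfun_sum _ _ (hphi n)).
rewrite (le_trans (ler_norm_sum _ _ _))//.
apply: (@le_trans _ _ (\sum_(i < m) ((M + 1) * `|z| * (e / D)))).
  apply: ler_sum => i _; rewrite normrM ler_pM//; last exact: ltW.
  by rewrite (le_trans (cM i))// ler_wpM2r// lerDl.
rewrite sumr_const card_ord -mulr_natl.
have -> : m%:R * ((M + 1) * `|z| * (e / D)) = (m%:R / m.+1%:R) * (e * `|z|).
  by rewrite /D; field; rewrite !gt_eqF// ltr_wpDl.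
rewrite ler_piMl ?mulr_ge0// ?(ltW e0)//.
by rewrite ler_pdivrMr// mul1r ler_nat.
Qed.

End FiniteDimension.

(** * Sobczyk's theorem *)

Section Sobczyk.
Context (R : realType) (X : normedModType R).

(** The weak-star compactness of balls of the dual, in the form needed below. *)
Lemma bfun_ultralim C (g : nat -> X -> R) (U : set_system nat) :
  UltraFilter U -> (forall n, bounded_functional C (g n)) ->
  exists2 f, bounded_functional C f & forall x, g n x @[n --> U] --> f x.
Proof.
move=> FU hg.
have lim x : exists2 p : R, `|p| <= C * `|x| & g n x @[n --> U] --> p.
  have [|p []] := @segment_compact R (- (C * `|x|)) (C * `|x|) (g n x @[n --> U]) _.
    apply: (@filterS _ U _ setT); last exact: filterT.
    by move=> n _ /=; rewrite in_itv/= -ler_norml (bfun_le _ (hg n)).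
  rewrite /= in_itv/= -ler_norml => px pcl; exists p => // B pB.
  have [//|nB] := in_ultra_setVsetC ((g ^~ x) @^-1` B) FU.
  by have [y []] := pcl (~` B) B nB pB.
have [f hf] := choice (fun x => let: ex_intro2 p a b := lim x in
  ex_intro (fun p => `|p| <= C * `|x| /\ g n x @[n --> U] --> p) p (conj a b)).
exists f => [|x]; last by have [] := hf x.
split=> [a x y|x]; last by have [] := hf x.
have [_ fx] := hf x; have [_ fy] := hf y; have [_ faxy] := hf (a *: x + y).
rewrite -(cvg_lim (@Rhausdorff R) faxy); apply: cvg_lim => //.
under eq_cvg do rewrite (bfun_lin _ _ _ (hg _)).
by apply: cvgD => //; exact: cvgMr.
Qed.

Lemma countable_enum T (x0 : T) (Q : set T) : countable Q ->
  exists e : nat -> T, Q `<=` range e.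
Proof.
move=> /pfcard_geP[->|[e]]; first by exists (fun=> x0).
by exists e => q /(@surj _ _ _ _ e)[n _ <-]; exists n.
Qed.

(** Every weak-star cluster point of g_n vanishes on Z, so for large n the
   functional g_n is close, at any given finite set of points of Q, to some
   functional that has norm at most C and vanishes on Z. Subtracting from g_n the
   best such functional keeps its values on Z and makes the sequence null on
   Q. *)
Lemma sobczyk C (g : nat -> X -> R) (Z Q : set X) : 0 <= C ->
  (forall n, bounded_functional C (g n)) ->
  (forall z, Z z -> g n z @[n --> \oo] --> (0 : R)) -> countable Q ->
  exists psi : nat -> X -> R, [/\ forall n, bounded_functional (C + C) (psi n),
    forall n z, Z z -> psi n z = g n z &
    forall q, Q q -> psi n q @[n --> \oo] --> (0 : R)].
Proof.
move=> C0 hg gZ Qc; have [e Qe] := countable_enum (0 : X) Qc.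
pose good k n chi := [/\ bounded_functional C chi, forall z, Z z -> chi z = 0 &
  forall i, (i < k)%N -> `|g n (e i) - chi (e i)| < k.+1%:R^-1].
(* Otherwise a limit of g along an ultrafilter on the bad n is itself close to
   some bad g n. *)
have evgood k : \forall n \near \oo, exists chi, good k n chi.
  apply: contrapT => nk.
  pose B := [set n | ~ exists chi, good k n chi].
  have PF : ProperFilter (within B \oo).
    split; last exact: within_filter.
    apply: contra_not nk; rewrite /within/= => nB.
    by apply: filterS nB => n nB; exact: contrapT.
  have [U [FU BU]] := ultraFilterLemma PF.
  have [f hf fU] := bfun_ultralim FU hg.
  have oU A : nbhs \oo A -> U A.
    by move=> oA; apply: (BU A); rewrite /within/=; exact: filterS oA.
  have f0 z : Z z -> f z = 0.
    move=> Zz; rewrite -(cvg_lim (@Rhausdorff R) (fU z)); apply: cvg_lim => //.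
    by move=> A /(gZ _ Zz); exact: oU.
  have k0 : 0 < k.+1%:R^-1 :> R by rewrite invr_gt0.
  have UBf : U (B `&` [set n | forall i : 'I_k, `|g n (e i) - f (e i)| < k.+1%:R^-1]).
    apply: filterI; first exact: (BU _ (withinT B _)).
    apply: filter_forall => i.
    by have /cvgrPdistC_lt/(_ _ k0) := fU (e i).
  have [n [nB nf]] := filter_ex UBf.
  by apply: nB; exists f; split=> // i ik; exact: (nf (Ordinal ik)).
(* The order k of approximation taken at n is the largest possible one up to n;
   it tends to infinity because each order is eventually possible. The bound
   k <= n serves for a largest one to exist. *)
have /choice[chi hchi] n : exists chi, [/\ bounded_functional C chi,
    forall z, Z z -> chi z = 0 &
    forall k, (k <= n)%N -> (exists c, good k n c) ->
    forall i, (i < k)%N -> `|g n (e i) - chi (e i)| < k.+1%:R^-1].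
  pose P k := (k <= n)%N && `[< exists c, good k n c >].
  have P0 : exists k, P k.
    exists 0%N; apply/andP; split=> //; apply/asboolP; exists (fun=> 0); split=> //.
    by split=> *; rewrite ?mulr0 ?addr0// normr0 mulr_ge0.
  have Pn k : P k -> (k <= n)%N by case/andP.
  have [k /andP[kn /asboolP[c [hc cZ ck]]] kmax] := ex_maxnP P0 Pn.
  exists c; split=> // k' k'n k'good i ik'.
  have k'k : (k' <= k)%N by apply: kmax; rewrite /P k'n; exact/asboolP.
  apply: (lt_le_trans (ck i (leq_trans ik' k'k))).
  by rewrite lef_pV2 ?posrE// ler_nat.
exists (fun n x => g n x - chi n x); split=> [n|n z Zz|q /Qe[i _ <-]].
- by have [hc _ _] := hchi n; exact: bfun_sub.
- by have [_ cZ _] := hchi n; rewrite cZ// subr0.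
apply/cvgr0Pnorm_lt => eps eps0.
have [N _ HN] := near_infty_natSinv_lt (PosNum eps0).
pose k := maxn N i.+1.
near=> n.
have [_ _ H] := hchi n.
apply: (@lt_trans _ _ k.+1%:R^-1); last by apply: HN; exact: leq_maxl.
apply: H; last exact: leq_maxr.
  by near: n; exact: nbhs_infty_ge.
by near: n; exact: evgood.
Unshelve. all: by end_near. Qed.
End Sobczyk.

(** * Norm-preserving extensions, countable unions, well-founded induction *)

Lemma bfun_comp (R : realType) (E F : normedModType R) (C : R) (f : F -> R)
    (h : {linear E -> F}) : (forall z, `|h z| <= `|z|) -> 0 <= C ->
  bounded_functional C f -> bounded_functional C (f \o h).
Proof.
move=> hle C0 [fl fb]; split=> [a x y|x] /=; first by rewrite linearP fl.
by rewrite (le_trans (fb _))// ler_wpM2l.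
Qed.

(** The bound to preserve is the norm, that is the least bound; preserving it
   preserves every other one. The extension is chosen once and for all as a
   function of g, which makes the transfinite construction below
   deterministic. *)
Lemma norm_preserving_extension (R : realType) (E F : normedModType R)
    (u : isometric_embedding E F) :
  exists ext : (E -> R) -> F -> R, forall C g, 0 <= C ->
    bounded_functional C g ->
    (forall z, ext g (u z) = g z) /\ bounded_functional C (ext g).
Proof.
suff /choice[ext hext] g : exists h : F -> R, forall C, 0 <= C ->
    bounded_functional C g ->
    (forall z, h (u z) = g z) /\ bounded_functional C h.
  by exists ext => C g; exact: hext.
pose A := [set c : R | 0 <= c /\ bounded_functional c g].
have [[C0 AC0]|nA] := pselect (A !=set0); last first.
  by exists (fun=> 0) => C C0 gC; exfalso; apply: nA; exists C.
have Ainf : has_inf A by split; [exists C0|exists 0 => c []].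
have m0 : 0 <= inf A by apply: lb_le_inf => [|c []//]; exists C0.
have gm : bounded_functional (inf A) g.
  have [_ hg] := AC0; split=> [a x y|z]; first exact: bfun_lin hg.
  have [->|z0] := eqVneq z 0; first by rewrite (bfun0 hg) !normr0 mulr0.
  rewrite -ler_pdivrMr ?normr_gt0//; apply: lb_le_inf; first by exists C0.
  by move=> c [c0 hc]; rewrite ler_pdivrMr ?normr_gt0//; exact: bfun_le hc.
have [|h hh hG] := @hahn_banach R F (inf A) [set p | exists z, p = (u z, g z)] m0.
  split=> [a _ _ _ _ [x [-> ->]] [y [-> ->]]|_ _ [z [-> ->]]].
    by exists (a *: x + y); rewrite linearP (bfun_lin _ _ _ gm).
  by rewrite isometric_embeddingP; exact: bfun_le gm.
exists h => C C1 gC; split=> [z|]; first by apply: hG; exists z.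
split=> [a x y|x]; first exact: bfun_lin hh.
rewrite (le_trans (bfun_le _ hh))// ler_wpM2r//.
by apply: ge_inf; [exists 0 => c []|].
Qed.

Lemma countable_setU T (A B : set T) :
  countable A -> countable B -> countable (A `|` B).
Proof.
move=> cA cB; rewrite -bigcup2E; apply: bigcup_countable => // -[|[|n]] _ //=.
Qed.

Section WellOrder.
Context (d : Order.disp_t) (I : orderType d).
Context (wo : wochoice.well_order (<=%O : rel I)).

Lemma wo_ind (P : I -> Prop) :
  (forall b, (forall c, (c < b)%O -> P c) -> P b) -> forall b, P b.
Proof.
move=> step b; apply: contrapT => nPb.
have [|m [[/asboolP nPm mmin] _]] := wo (A := [pred x | `[< ~ P x >]]).
  by exists b; exact/asboolP.
apply: nPm; apply: step => c cm; apply: contrapT => nPc.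
have /mmin : c \in [pred x | `[< ~ P x >]] by exact/asboolP.
by rewrite leNgt cm.
Qed.

End WellOrder.

(** * Chains of finite-dimensional extensions *)

(** The data of one pushout step, read inside X: cell_incl is the inclusion of E
   in F, and cell_map sends F to its image in X. *)
Record cell (R : realType) (X : normedModType R) := Cell {
  cell_dom : normedModType R ;
  cell_cod : normedModType R ;
  cell_incl : isometric_embedding cell_dom cell_cod ;
  cell_map : {linear cell_cod -> X} }.

Arguments cell_incl {R X} _.
Arguments cell_map {R X} _.

(** L plays the role of the part of X already built and V that of the next member
   of the chain. The fourth clause says that the norm of L + k(F) is the pushout
   norm, in the only direction that is not automatic; the last one asks
   only for density, so that limit steps are also of this form, with F = 0 and L
   the union of the previous members. *)
Definition attaches (R : realType) (X : normedModType R) (L V : set X)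
    (D : cell X) :=
  let u := cell_incl D in let k := cell_map D in
  [/\ finite_dimensional (cell_dom D), finite_dimensional (cell_cod D),
      [/\ forall z, L (k (u z)), forall f, V (k f) & forall f, `|k f| <= `|f|],
      forall y f e, L y -> 0 < e ->
        exists z, `|y + k (u z)| + `|f - u z| <= `|y + k f| + e &
      V `<=` closure [set x | exists y f, L y /\ x = y + k f]].

Section Chain.
Context (R : realType) (X : normedModType R).
Context (d : Order.disp_t) (I : orderType d) (V : I -> set X) (D : I -> cell X).

(** The point 0 is added to have a subspace also when b is the first index. *)
Definition below b : set X := [set x | x = 0 \/ exists2 c, (c < b)%O & V c x].

Context (wo : wochoice.well_order (<=%O : rel I)).
Context (Vlin : forall b, linear_subspace (V b)).
Context (Vmono : forall b c, (b <= c)%O -> V b `<=` V c).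
Context (VD : forall b, ~ is_first b -> attaches (below b) (V b) (D b)).

Local Notation u b := (cell_incl (D b)).
Local Notation k b := (cell_map (D b)).

Lemma below_sub b : below b `<=` V b.
Proof.
move=> x [->|[c cb Vcx]]; first by have [] := Vlin b.
exact: Vmono (ltW cb) _ Vcx.
Qed.

Lemma below_lin b : linear_subspace (below b).
Proof.
split=> [|a x y [->|[c cb cx]]]; first by left.
  rewrite scaler0 add0r; case => [->|]; first by left.
  by right.
case=> [->|[c' c'b c'y]]; right.
  by exists c => //; rewrite addr0 -[a *: x]addr0; have [V0 Vl] := Vlin c; exact: Vl.
exists (Order.max c c'); first by rewrite gt_max cb.
have [_ Vl] := Vlin (Order.max c c').
by apply: Vl; [apply: Vmono cx|apply: Vmono c'y]; rewrite le_max lexx// orbT.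
Qed.

Definition generators (N : set I) : set X :=
  [set x | exists b, is_first b /\ V b x] `|`
  [set x | exists b, [/\ N b, ~ is_first b & exists f, x = k b f]].

(** By Hahn-Banach, this says that x lies in the closed linear span of the first
   member of the chain and of the images of the F_b for b in N. The dual form is
   the one that gets used, and spares the construction of spans. *)
Definition determines (N : set I) (x : X) := forall C chi, 0 <= C ->
  bounded_functional C chi -> (forall y, generators N y -> chi y = 0) ->
  chi x = 0.

Lemma generators_sub N M : N `<=` M -> generators N `<=` generators M.
Proof.
move=> NM x [|[b [Nb nb bx]]]; first by left.
by right; exists b; split => //; exact: NM.
Qed.

Lemma determines_sub N M x : N `<=` M -> determines N x -> determines M x.
Proof.
move=> NM Nx C chi C0 hchi chi0; apply: (Nx C) => // y Ny.
by apply: chi0; exact: generators_sub Ny.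
Qed.

(** A point of a closure is the limit of a sequence, and a countable union of
   countable supports is countable. *)
Lemma determines_closure (A : set X) (J : set I) x :
  (forall y, A y -> exists N : set I,
     [/\ countable N, N `<=` J & determines N y]) ->
  closure A x -> exists N : set I, [/\ countable N, N `<=` J & determines N x].
Proof.
move=> detA Ax.
have /choice[w hw] (n : nat) : exists w : X * set I,
    `|x - w.1| < n.+1%:R^-1 /\
    [/\ countable w.2, w.2 `<=` J & determines w.2 w.1].
  have [|y Ay xy] := closure_approx (e := n.+1%:R^-1) Ax.
    by rewrite invr_gt0.
  by have [N NP] := detA y Ay; exists (y, N).
exists (\bigcup_n (w n).2); split.
- by apply: bigcup_countable => // n _; have [_ []] := hw n.
- by move=> c [n _]; have [_ [_ + _]] := hw n; apply.
move=> C chi C0 hchi chi0.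
have h0 : bounded_functional C (fun _ : X => 0 : R).
  by split=> *; rewrite ?mulr0 ?addr0// normr0 mulr_ge0.
apply: (bfun_eq_closure (A := [set y | chi y = 0]) C0 hchi h0) => //.
move=> B /nbhs_ballP[e /= e0 eB].
have [N _ HN] := near_infty_natSinv_lt (PosNum e0).
have [xw [_ _ detw]] := hw N; exists (w N).1; split.
  by apply: (determines_sub _ detw C0 hchi chi0) => c Nc; exists N.
apply: eB; rewrite -ball_normE/=; apply: (lt_trans xw).
by apply: HN; exact: leqnn.
Qed.

Lemma determines_countable b x : V b x -> exists N : set I,
  [/\ countable N, N `<=` [set c | (c <= b)%O] & determines N x].
Proof.
elim/(wo_ind wo): b x => b IH x Vbx.
have [bf|nbf] := pselect (is_first b).
  exists set0; split=> // C chi C0 hchi; apply.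
  by left; exists b.
have [_ _ _ _ Vcl] := VD nbf.
apply: determines_closure (Vcl _ Vbx) => _ [y [f [Ly ->]]].
have [N [Nc Nb Ny]] : exists N : set I,
    [/\ countable N, N `<=` [set c | (c <= b)%O] & determines N y].
  case: Ly => [->|[c cb cy]].
    by exists set0; split=> // C chi C0 hchi _; exact: bfun0 hchi.
  have [N [Nc Nb Ny]] := IH _ cb _ cy; exists N; split=> // c' /Nb /le_trans.
  by apply; exact: ltW.
exists (N `|` [set b]); split.
- by apply: countable_setU => //; exact: countable1.
- by move=> c [/Nb//|->]; exact: lexx.
move=> C chi C0 hchi chi0.
rewrite (bfunD _ _ hchi) (determines_sub _ Ny C0 hchi chi0) ?add0r.
  by apply: chi0; right; exists b; split => //; [right|exists f].
by move=> c; left.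
Qed.

(** The image of E lies in the union of the members of the chain before b, and it
   is spanned by finitely many points, so its support is countable and strictly
   below b. *)
Lemma cell_determined b : ~ is_first b -> exists N : set I,
  [/\ countable N, forall c, N c -> (c < b)%O &
      forall z, determines N (k b (u b z))].
Proof.
move=> nbf; have [Efd _ [kuL _ _] _ _] := VD nbf.
have [m [v [M [_ vM]]]] := fd_basis Efd.
have /choice[N hN] (i : 'I_m) : exists N : set I, [/\ countable N,
    forall c, N c -> (c < b)%O & determines N (k b (u b (v i)))].
  case: (kuL (v i)) => [->|[c cb /determines_countable[N [Nc Nb Nx]]]].
    by exists set0; split=> // C chi C0 hchi _; exact: bfun0 hchi.
  by exists N; split=> // c' /Nb /le_lt_trans; apply.
exists (\bigcup_i N i); split.
- by apply: bigcup_countable => // i _; have [] := hN i.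
- by move=> c [i _]; have [_ + _] := hN i; apply.
move=> z C chi C0 hchi chi0; have [c -> _] := vM z.
rewrite !linear_sum/=.
under eq_bigr do rewrite !linearZ/=.
rewrite (bfun_sum _ _ hchi) big1// => i _; have [_ _ Ni] := hN i.
rewrite (determines_sub _ Ni C0 hchi chi0) ?mulr0//.
by move=> c' Nc'; exists i.
Qed.

(** The countable set of steps is closed under passing to supports by iterating
   countably often. *)
Lemma support_closure (N0 : set I) : countable N0 -> exists S : set I,
  [/\ countable S, N0 `<=` S & forall b, S b -> ~ is_first b ->
      forall z, determines (S `&` [set c | (c < b)%O]) (k b (u b z))].
Proof.
move=> N0c.
have /choice[N hN] b : exists N : set I, countable N /\ (~ is_first b ->
    (forall c, N c -> (c < b)%O) /\ forall z, determines N (k b (u b z))).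
  have [bf|nbf] := pselect (is_first b); first by exists set0; split.
  by have [N [Nc Nb Nz]] := cell_determined nbf; exists N.
pose S := fix S n := if n is n'.+1 then \bigcup_(b in S n') N b else N0.
exists (\bigcup_n S n); split.
- apply: bigcup_countable => // n _; elim: n => //= n IH.
  by apply: bigcup_countable => // b _; have [] := hN b.
- by move=> b N0b; exists 0%N.
move=> b [n _ Sb] nbf z; have [_ /(_ nbf)[Nb Nz]] := hN b.
apply: determines_sub (Nz z) => c Nc; split; last exact: Nb.
by exists n.+1 => //; exists b.
Qed.

Section Canonical.
Context (S : set I) (ext : forall b, (cell_dom (D b) -> R) -> cell_cod (D b) -> R).
Context (C : R) (C0 : 0 <= C).
Context (Sclosed : forall b, S b -> ~ is_first b ->
  forall z, determines (S `&` [set c | (c < b)%O]) (k b (u b z))).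
Context (extP : forall b c g, 0 <= c -> bounded_functional c g ->
  (forall z, ext g (u b z) = g z) /\ bounded_functional c (ext g)).

Implicit Types (psi phi : X -> R).

(** The recursion that phi has to obey at b: psi dictates its values on the first
   member and at the steps in S, the chosen norm-preserving extension those at
   every other step. The functional phi is defined on all of X, but only its
   values on V b matter ([follows_eq]). *)
Definition follows psi b phi :=
  [/\ is_first b -> forall x, V b x -> phi x = psi x,
      ~ is_first b -> S b -> forall f, phi (k b f) = psi (k b f) &
      ~ is_first b -> ~ S b ->
        forall f, phi (k b f) = ext (fun z => phi (k b (u b z))) f].

Lemma follows_eq psi b phi phi' : (forall x, V b x -> phi x = phi' x) ->
  follows psi b phi -> follows psi b phi'.
Proof.
move=> pp' [H1 H2 H3]; split=> [bf x bx|nbf Sb f|nbf Sb f].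
- by rewrite -pp'// H1.
- by have [_ _ [_ kV _] _ _] := VD nbf; rewrite -pp'// H2.
have [_ _ [kuL kV _] _ _] := VD nbf; rewrite -pp'// H3//; congr (ext _ f).
by apply/funext => z; apply: pp'; exact: below_sub.
Qed.

(** At each step the values on E, which lie below, fix those on F, and density
   takes care of the rest. *)
Lemma follows_uniq psi b phi phi' :
  bounded_functional C phi -> bounded_functional C phi' ->
  (forall c, (c <= b)%O -> follows psi c phi) ->
  (forall c, (c <= b)%O -> follows psi c phi') ->
  forall x, V b x -> phi x = phi' x.
Proof.
move=> hphi hphi'; elim/(wo_ind wo): b => b IH Hphi Hphi'.
have [F1 F2 F3] := Hphi _ (lexx b); have [G1 G2 G3] := Hphi' _ (lexx b).
have [bf|nbf] := pselect (is_first b).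
  by move=> x bx; rewrite F1// G1.
have agree x : below b x -> phi x = phi' x.
  case=> [->|[c cb cx]]; first by rewrite (bfun0 hphi) (bfun0 hphi').
  by apply: (IH c) => // e ec; [apply: Hphi|apply: Hphi'];
    exact: le_trans ec (ltW cb).
have [_ _ [kuL _ _] _ Vcl] := VD nbf.
move=> x /Vcl; apply: (bfun_eq_closure C0 hphi hphi') => _ [y [f [Ly ->]]].
rewrite (bfunD _ _ hphi) (bfunD _ _ hphi') agree//; congr (_ + _).
have [Sb|nSb] := pselect (S b); first by rewrite F2// G2.
rewrite F3// G3//; congr (ext _ f).
by apply/funext => z; exact: agree.
Qed.

(** The values of the functionals given at the b in J form a bounded graph,
   because they agree where they are comparable; Hahn-Banach extends it to X. *)
Lemma follows_glue psi (J : set I) :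
  (forall b c, J b -> (c <= b)%O -> J c) ->
  (forall b, J b -> exists2 phi, bounded_functional C phi &
     forall c, (c <= b)%O -> follows psi c phi) ->
  exists2 phi, bounded_functional C phi & forall b, J b -> follows psi b phi.
Proof.
move=> Jdown Jex.
have /choice[p hp] b : exists phi, J b -> bounded_functional C phi /\
     forall c, (c <= b)%O -> follows psi c phi.
  have [Jb|nJb] := pselect (J b); last by exists (fun=> 0).
  by have [phi ? ?] := Jex b Jb; exists phi.
have agree b c x : J c -> (b <= c)%O -> V b x -> p c x = p b x.
  move=> Jc bc bx; have [h1 h2] := hp _ Jc; have [h3 h4] := hp _ (Jdown _ _ Jc bc).
  apply: (follows_uniq h1 h3 _ h4 bx) => e eb; apply: h2; exact: le_trans bc.
pose G : set (X * R) := [set q | exists b x, [/\ J b, V b x & q = (x, p b x)]].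
have [|phi hphi phiG] := hahn_banach (G := G) C0.
  split=> [a _ _ _ _ [b [x [Jb bx [-> ->]]]] [b' [x' [Jb' bx' [-> ->]]]]|].
    pose m := Order.max b b'.
    have Jm : J m by rewrite /m; case: (leP b b').
    have bm : (b <= m)%O by rewrite le_max lexx.
    have b'm : (b' <= m)%O by rewrite le_max lexx orbT.
    exists m, (a *: x + x'); split=> //.
      by have [_ Vl] := Vlin m; apply: Vl; [exact: Vmono bx|exact: Vmono bx'].
    have [pm _] := hp _ Jm.
    by rewrite (bfun_lin _ _ _ pm) (agree b m x)// (agree b' m x').
  move=> _ _ [b [x [Jb bx [-> ->]]]]; have [pb _] := hp _ Jb; exact: bfun_le pb.
exists phi => // b Jb; have [pb pf] := hp _ Jb.
apply: follows_eq (pf b (lexx b)) => x bx; apply/esym/phiG.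
by exists b, x.
Qed.

(** Gluing gives phi0 below b. It remains to add the prescribed functional theta
   on F: the pair (phi0, theta) agrees on E, so its value at y + k f can be
   computed from any other representation y + k (u z), f - u z, and the pushout
   norm makes one of these cheap enough to get the bound C. For b in S the
   agreement on E is the closure property of S: phi0 and psi coincide on the
   generators that determine the image of E. *)
Lemma follows_exists psi b : bounded_functional C psi ->
  exists2 phi, bounded_functional C phi &
    forall c, (c <= b)%O -> follows psi c phi.
Proof.
move=> hpsi; elim/(wo_ind wo): b => b IH.
have [|phi0 hphi0 F0] := @follows_glue psi [set c | (c < b)%O] _ IH.
  by move=> c e /= cb ec; exact: le_lt_trans cb.
have [bf|nbf] := pselect (is_first b).
  exists psi => // c cb; have -> : c = b by apply/le_anti; rewrite cb bf.
  by split.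
have [_ _ [kuL kV kle] knorm _] := VD nbf.
have hku : bounded_functional C (fun z => phi0 (k b (u b z))).
  apply: (bfun_comp (f := fun f => phi0 (k b f)) (h := u b)) => //.
    by move=> z; rewrite isometric_embeddingP.
  exact: (bfun_comp (f := phi0) (h := k b)).
have [theta [htheta thetau tS tnS]] : exists theta : cell_cod (D b) -> R,
    [/\ bounded_functional C theta,
      forall z, theta (u b z) = phi0 (k b (u b z)),
      S b -> forall f, theta f = psi (k b f) &
      ~ S b -> forall f, theta f = ext (fun z => phi0 (k b (u b z))) f].
  have [Sb|nSb] := pselect (S b); last first.
    by have [e1 e2] := extP C0 hku; exists (ext (fun z => phi0 (k b (u b z)))).
  exists (fun f => psi (k b f)); split=> //.
    exact: (bfun_comp (f := psi) (h := k b)).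
  move=> z; apply/eqP; rewrite eq_sym -subr_eq0; apply/eqP.
  apply: (Sclosed Sb nbf z (addr_ge0 C0 C0) (bfun_sub hphi0 hpsi)).
  move=> w [[c [cf cx]]|[c [[Sc cb] ncf [f ->]]]].
    have cb : (c < b)%O.
      by rewrite lt_neqAle cf andbT; apply: contra_notN nbf => /eqP <-.
    by have [-> //] := F0 _ cb; rewrite subrr.
  by have [_ -> // _] := F0 _ cb; rewrite subrr.
pose G : set (X * R) :=
  [set q | exists y f, below b y /\ q = (y + k b f, phi0 y + theta f)].
have [|phi hphi phiG] := hahn_banach (G := G) C0.
  split=> [a _ _ _ _ [y [f [Ly [-> ->]]]] [y' [f' [Ly' [-> ->]]]]|].
    exists (a *: y + y'), (a *: f + f'); split.
      by have [_ Ll] := below_lin b; exact: Ll.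
    rewrite linearP scalerDr addrACA; congr (_, _).
    by rewrite (bfun_lin _ _ _ hphi0) (bfun_lin _ _ _ htheta); ring.
  move=> _ _ [y [f [Ly [-> ->]]]].
  have [C00|Cn0] := eqVneq C 0.
    have := bfun_le y hphi0; have := bfun_le f htheta.
    by rewrite C00 !mul0r !normr_le0 => /eqP -> /eqP ->; rewrite addr0.
  have Cp : 0 < C by rewrite lt_def Cn0.
  apply/ler_addgt0Pr => e e0.
  have [z hz] := knorm y f (e / C) Ly (divr_gt0 e0 Cp).
  have -> : phi0 y + theta f = phi0 (y + k b (u b z)) + theta (f - u b z).
    by rewrite (bfunD _ _ hphi0) (bfunB _ _ htheta) thetau; ring.
  rewrite (le_trans (ler_normD _ _))//.
  apply: (@le_trans _ _ (C * (`|y + k b (u b z)| + `|f - u b z|))).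
    by rewrite mulrDr lerD ?(bfun_le _ hphi0) ?(bfun_le _ htheta).
  by rewrite (le_trans (ler_wpM2l C0 hz))// mulrDr [C * (e / C)]mulrC divfK.
have phiL y : below b y -> phi y = phi0 y.
  move=> Ly; apply: phiG; exists y, 0; split=> //.
  by rewrite linear0 (bfun0 htheta) !addr0.
have phik f : phi (k b f) = theta f.
  apply: phiG; exists 0, f; split; first by left.
  by rewrite (bfun0 hphi0) !add0r.
exists phi => // c; rewrite le_eqVlt => /orP[/eqP ->|cb]; last first.
  apply: follows_eq (F0 c cb) => x cx; apply/esym/phiL.
  by right; exists c.
split=> // _ Sb f; first by rewrite phik tS.
rewrite phik tnS//; congr (ext _ f).
by apply/funext => z; rewrite phiL.
Qed.

(** Only the steps outside S need an argument: there phi_n tends to 0 uniformly on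
   the unit ball of E, and the norm-preserving extension transports this bound
   to F. *)
Lemma follows_null (psi phi : nat -> X -> R) :
  (forall n, bounded_functional C (phi n)) ->
  (forall n b, follows (psi n) b (phi n)) ->
  (forall y, generators S y -> psi n y @[n --> \oo] --> (0 : R)) ->
  forall b x, V b x -> phi n x @[n --> \oo] --> (0 : R).
Proof.
move=> hphi F psi0 b; elim/(wo_ind wo): b => b IH x Vbx.
have [bf|nbf] := pselect (is_first b).
  have -> : (fun n => phi n x) = (fun n => psi n x).
    by apply/funext => n; have [-> //] := F n b.
  by apply: psi0; left; exists b.
have [Efd _ [kuL kV kle] _ Vcl] := VD nbf.
have L0 y : below b y -> phi n y @[n --> \oo] --> (0 : R).
  case=> [->|[c cb cy]]; last exact: (IH c cb y cy).
  by under eq_cvg do rewrite (bfun0 (hphi _)); exact: cvg_cst.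
apply: (bfun_null_closure C0 hphi _ (Vcl x Vbx)) => _ [y [f [Ly ->]]].
under eq_cvg do rewrite (bfunD _ _ (hphi _)).
suff kf0 : phi n (k b f) @[n --> \oo] --> (0 : R).
  have : phi n y + phi n (k b f) @[n --> \oo] --> (0 + 0 : R).
    by apply: cvgD => //; exact: L0.
  by rewrite addr0.
have [Sb|nSb] := pselect (S b).
  have -> : (fun n => phi n (k b f)) = (fun n => psi n (k b f)).
    by apply/funext => n; have [_ -> // _] := F n b.
  by apply: psi0; right; exists b; split=> //; exists f.
have hku n : bounded_functional C (fun z => phi n (k b (u b z))).
  apply: (bfun_comp (f := fun f => phi n (k b f)) (h := u b)) => //.
    by move=> z; rewrite isometric_embeddingP.
  exact: (bfun_comp (f := phi n) (h := k b)).
have ku0 z : phi n (k b (u b z)) @[n --> \oo] --> (0 : R) by exact: L0.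
apply/cvgr0Pnorm_lt => e e0.
pose e' := e / (`|f| + 1).
have f1 : 0 < `|f| + 1 by rewrite ltr_wpDl.
have e'0 : 0 < e' by rewrite divr_gt0.
have := fd_uniform_null Efd hku ku0 e'0; apply: filterS => n small.
have [_ _ ->] := F n b => //.
have hku' : bounded_functional e' (fun z => phi n (k b (u b z))).
  by split=> // a y' z; exact: bfun_lin (hku n).
have [_ hext] := extP (ltW e'0) hku'.
rewrite (le_lt_trans (bfun_le _ hext))// /e' mulrAC ltr_pdivrMr//.
by rewrite ltr_pM2l// ltrDl.
Qed.

End Canonical.

(** Sobczyk's theorem is applied with Q the union of a dense subset of the first
   member and of bases of the F_b for b in S, the steps that carry the support
   of Z0. *)
Lemma c0_valued_extension (Q0 Z0 : set X) (C : R) (g : nat -> X -> R) :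
  countable Q0 -> (forall b, is_first b -> V b `<=` closure Q0) ->
  closure (\bigcup_b V b) = setT -> countable Z0 -> 0 <= C ->
  (forall n, bounded_functional C (g n)) ->
  (forall z, Z0 z -> g n z @[n --> \oo] --> (0 : R)) ->
  exists phi : nat -> X -> R, [/\ forall n, bounded_functional (C + C) (phi n),
    forall x, phi n x @[n --> \oo] --> (0 : R) &
    forall n z, Z0 z -> phi n z = g n z].
Proof.
move=> Q0c Q0V Vtot Z0c C0 hg gZ.
pose ext b := projT1 (cid (norm_preserving_extension (u b))).
have extP b c h : 0 <= c -> bounded_functional c h ->
    (forall z, ext b h (u b z) = h z) /\ bounded_functional c (ext b h).
  exact: (projT2 (cid (norm_preserving_extension (u b)))).
have /choice[N hN] z : exists N : set I, countable N /\ determines N z.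
  have [||N [Nc _ Nz]] := @determines_closure (\bigcup_b V b) setT z.
  - by move=> y [b _ /determines_countable[N [Nc _ Ny]]]; exists N.
  - by rewrite Vtot.
  - by exists N.
have [|S [Sc NS Sclosed]] := @support_closure (\bigcup_(z in Z0) N z).
  by apply: bigcup_countable => // z _; have [] := hN z.
have /choice[B hB] b : exists B : set X, countable B /\ (~ is_first b ->
    forall C' (h : nat -> X -> R), (forall n, bounded_functional C' (h n)) ->
    (forall y, B y -> h n y @[n --> \oo] --> (0 : R)) ->
    forall f, h n (k b f) @[n --> \oo] --> (0 : R)).
  have [bf|nbf] := pselect (is_first b); first by exists set0; split.
  have [_ Ffd _ _ _] := VD nbf; have [m [v [M [_ vM]]]] := fd_basis Ffd.
  exists (range (fun i => k b (v i))); split; first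
    exact/finite_set_countable/finite_image/finite_finset.
  move=> _ C' h hh hB f; have [c -> _] := vM f.
  have hE n : h n (k b (\sum_i c i *: v i)) = \sum_i c i * h n (k b (v i)).
    rewrite linear_sum/= -(bfun_sum _ _ (hh n)); congr (h n _).
    by apply: eq_bigr => i _; rewrite linearZ.
  have -> : (fun n => h n (k b (\sum_i c i *: v i))) =
      (fun n => \sum_i c i * h n (k b (v i))) by exact/funext.
  have : (fun n => \sum_i c i * h n (k b (v i))) @ \oo --> \sum_i c i * (0 : R).
    apply: (@cvg_big R 'I_m +%R 0 xpredT _ nat \oo (index_enum _)
      (fun i n => c i * h n (k b (v i))) (fun i => c i * 0)) => [|i _].
      exact: add_continuous.
    by apply: cvgMr; apply: hB; exists i.
  by rewrite big1// => i _; rewrite mulr0.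
have [|psi [hpsi psig psiQ]] :=
    @sobczyk R X C g Z0 (Q0 `|` \bigcup_(b in S) B b) C0 hg gZ.
  apply: countable_setU => //; apply: bigcup_countable => // b _.
  by have [] := hB b.
have CC : 0 <= C + C by rewrite addr_ge0.
have psi0 y : generators S y -> psi n y @[n --> \oo] --> (0 : R).
  case=> [[b [bf bx]]|[b [Sb nbf [f ->]]]].
    apply: (bfun_null_closure CC hpsi _ (Q0V b bf y bx)) => q Qq.
    by apply: psiQ; left.
  have [_ /(_ nbf)bB] := hB b; apply: bB => // q Bq.
  by apply: psiQ; right; exists b.
have /choice[phi hphi] n : exists phi, bounded_functional (C + C) phi /\
    forall b, follows S ext (psi n) b phi.
  have [//||phi hphi F] := @follows_glue S ext (C + C) CC (psi n) setT.
    by move=> b _; exact: (follows_exists CC Sclosed extP).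
  by exists phi; split=> // b; exact: F.
exists phi; split=> [n|x|n z Zz].
- by have [] := hphi n.
- have hphi1 n : bounded_functional (C + C) (phi n) by have [] := hphi n.
  apply: (bfun_null_closure (A := \bigcup_b V b) CC hphi1); last by rewrite Vtot.
  move=> y [b _ yb]; apply: (follows_null CC extP hphi1 _ psi0 yb) => n c.
  by have [_] := hphi n; apply.
rewrite -psig//; apply/eqP; rewrite -subr_eq0; apply/eqP.
have [hphin F] := hphi n.
have Sz : determines S z.
  by have [_ Nz] := hN z; apply: determines_sub Nz => c Nc; apply: NS; exists z.
apply: (Sz _ _ (addr_ge0 CC CC) (bfun_sub hphin (hpsi n))) => w.
case=> [[b [bf bx]]|[b [Sb nbf [f ->]]]]; have [F1 F2 _] := F b.
  by rewrite F1// subrr.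
by rewrite F2// subrr.
Qed.

End Chain.

(** * The chains defining the class PO_fd *)

Lemma linear_pack (R : realType) (U W : lmodType R) (f : U -> W) :
  linear f -> exists k : {linear U -> W}, k =1 f.
Proof.
move=> lf; pose k : {linear U -> W} :=
  HB.pack f (GRing.isLinear.Build R U W *:%R f lf).
by exists k.
Qed.

Section Pushout.
Context (R : realType) (X : normedModType R).

(** In the pushout, any representative of the class of (f, y) is of the form
   (f - u z, y + j z), so the infimum that defines the norm is the one asked
   for. *)
Lemma pushout_attaches (Ya Yb : completeNormedModType R)
    (ea : isometric_embedding Ya X) (eb : isometric_embedding Yb X)
    (i : Ya -> Yb) : eb \o i =1 ea -> fd_pushout_map i ->
  exists D : cell X, attaches (range ea) (range eb) D.
Proof.
move=> ei [E [F [u [j [T [Efd Ffd Tsurj Ti]]]]]].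
have [k kE] : exists k : {linear F -> X},
    k =1 (fun f => eb (T (po_pi u j (f, 0)))).
  apply: linear_pack => a f f'; rewrite -!linearP; congr (eb (T (po_pi u j _))).
  by congr pair; rewrite /= scaler0 addr0.
have inrE y : ea y = eb (T (po_pi u j (0, y))).
  by rewrite -ei /= -Ti.
have kuE z : k (u z) = ea (j z).
  rewrite kE inrE; congr (eb (T _)); apply/po_piE; exists z.
  by congr pair; rewrite /= ?subr0 ?sub0r.
have sumE y f : ea y + k f = eb (T (po_pi u j (f, y))).
  rewrite inrE kE -!linearD; congr (eb (T (po_pi u j _))).
  by congr pair; rewrite /= ?add0r ?addr0.
exists (Cell u k); split=> //=.
- split=> [z|f|f]; first by exists (j z); rewrite ?kuE.
    by exists (T (po_pi u j (f, 0))); rewrite ?kE.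
  rewrite kE !isometric_embeddingP (le_trans (po_norm_le _ _ _))//=.
  by rewrite normr0 addr0.
- move=> _ f e [y _ <-] e0.
  have [p pE pe] := po_norm_adherent (po_pi u j (f, y)) e0.
  have /po_piE[z pz] := esym pE.
  exists z; rewrite kuE -linearD sumE !isometric_embeddingP.
  have [p1 p2] : p.1 = f - u z /\ p.2 = y + j z.
    split; first by have := congr1 fst pz => /= <-; rewrite opprB addrC subrK.
    have := congr1 snd pz => /= h.
    by rewrite -[j z]opprK -h opprB addrC subrK.
  by rewrite -p1 -p2 addrC; exact: ltW.
move=> _ [w _ <-]; apply: subset_closure.
have [q _ qw] : range T w by rewrite Tsurj.
exists (ea (repr q).2), (repr q).1; split; first by exists (repr q).2.
by rewrite sumE -qw -[in LHS](po_repr q); case: (repr q).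
Qed.

(** This covers the limit ordinals: the zero-dimensional cell adds nothing beyond
   the closure. *)
Lemma trivial_attaches (L V : set X) : L 0 -> V 0 -> V `<=` closure L ->
  exists D : cell X, attaches L V D.
Proof.
move=> L0 V0 VL.
pose u : isometric_embedding 'rV[R]_0 'rV[R]_0 :=
  Build_isometric_embedding (isometric_embedding_fun := idfun) (fun=> erefl).
have fd : finite_dimensional 'rV[R]_0.
  by exists 0%N; split; exists idfun => //; exists idfun.
exists (Cell u (\0 : {linear 'rV[R]_0 -> X})); split=> //=.
- by split=> // f; rewrite normr0.
- by move=> y f e Ly e0; exists f; rewrite !addr0 subrr normr0 addr0 lerDl ltW.
move=> x /VL; apply: closure_subset => y Ly.
by exists y, 0; rewrite addr0.
Qed.

Lemma dense_image_closure (Y : normedModType R) (e : isometric_embedding Y X)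
    (A : set Y) : dense A -> range e `<=` closure (e @` A).
Proof.
move=> dA _ [y _ <-] B /nbhs_ballP[r /= r0 rB].
have [|z [/= yz Az]] := dA (ball y r) _ (ball_open y r).
  by exists y; exact: ballxx.
exists (e z); split; first by exists z.
apply: rB; move: yz; rewrite -!ball_normE/= => yz.
by rewrite -linearB isometric_embeddingP.
Qed.

End Pushout.

Section Main.
Context (R : realType) (X : completeNormedModType R).

Lemma PO_fd_c0_valued_extension (Z0 : set X) (C : R) (g : nat -> X -> R) :
  PO_fd X -> countable Z0 -> 0 <= C ->
  (forall n, bounded_functional C (g n)) ->
  (forall z, Z0 z -> g n z @[n --> \oo] --> (0 : R)) ->
  exists phi : nat -> X -> R, [/\ forall n, bounded_functional (C + C) (phi n),
    forall x, phi n x @[n --> \oo] --> (0 : R) &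
    forall n z, Z0 z -> phi n z = g n z].
Proof.
move=> [d [I [Xs [e [[wo mono] fsep lim succ tot]]]]] Z0c C0 hg gZ.
pose V b : set X := range (e b).
have Vlin b : linear_subspace (V b).
  split=> [|a _ _ [x _ <-] [y _ <-]]; first by exists 0; rewrite ?linear0.
  by exists (a *: x + y); rewrite ?linearP.
have /choice[D VD] b : exists D : cell X,
    ~ is_first b -> attaches (below V b) (V b) D.
  have V0 c : V c 0 by have [] := Vlin c.
  (* At the first index any cell will do. *)
  have [bf|nbf] := pselect (is_first b).
    by have [D _] := trivial_attaches (V0 b) (V0 b) (@subset_closure _ _);
      exists D.
  have [[a ab]|nsucc] := pselect (exists a, is_succ a b); last first.
    have [|||D hD] := @trivial_attaches R X (below V b) (V b).
    - by left.
    - exact: V0.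
    - rewrite /V lim//; apply: closure_subset => x [c cb cx].
      by right; exists c.
    by exists D.
  have [i ei po] := succ _ _ ab; have [D hD] := pushout_attaches ei po.
  exists D => _; suff -> : below V b = V a by [].
  have [altb aleast] := ab.
  apply/seteqP; split=> [x [->|[c cb cx]]|x ax]; first exact: V0.
    apply: mono cx; rewrite leNgt; apply/negP => /aleast.
    by rewrite leNgt cb.
  by right; exists a.
have [Q0 [Q0c Q0V]] : exists Q0 : set X, countable Q0 /\
    forall b, is_first b -> V b `<=` closure Q0.
  have [[b bf]|nf] := pselect (exists b : I, is_first b); last first.
    by exists set0; split=> // b bf; exfalso; apply: nf; exists b.
  have [A Ac Ad] := fsep b bf.
  exists (e b @` A); split; first exact: sub_countable (card_image_le _ _) Ac.
  move=> c cf; have -> : c = b by apply/le_anti; rewrite cf bf.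
  exact: dense_image_closure.
exact: (c0_valued_extension wo Vlin mono VD Q0c Q0V tot Z0c C0 hg gZ).
Qed.

End Main.

(** * The space c_0 and complemented copies of it *)

Section C0Facts.
Context (R : realType).
Implicit Types w : c0 R.

Lemma c0_linE (a : R) w w' n : (a *: w + w') n = a * w n + w' n.
Proof. by []. Qed.

Lemma c0_subE w w' n : (w - w') n = w n - w' n.
Proof. by []. Qed.

Lemma c0_coord_bfun n : bounded_functional 1 (fun w => w n).
Proof.
split=> [a x y //|w]; rewrite mul1r; exact: c0_norm_ge.
Qed.

Lemma c0_cvg w : w n @[n --> \oo] --> (0 : R).
Proof. by apply/asboolP; exact: (c0_valP w). Qed.

Lemma c0_exists (s : nat -> R) : s n @[n --> \oo] --> (0 : R) ->
  exists w, w =1 s.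
Proof. by move=> s0; have s0b := asboolT s0; exists (@C0 R s s0b). Qed.

Lemma c0_eq w w' : w =1 w' -> w = w'.
Proof. by move=> ww'; apply/val_inj/funext. Qed.

Lemma eventually_zero_cvg (s : nat -> R) N :
  (forall n, (N <= n)%N -> s n = 0) -> s n @[n --> \oo] --> (0 : R).
Proof.
move=> sN; apply/cvgr0Pnorm_lt => e e0; exists N => // n /= /sN ->.
by rewrite normr0.
Qed.

(** The truncations of w belong to A, by induction on their length, and tend to w
   in the supremum norm. *)
Lemma c0_closure_span (A : set (c0 R)) :
  linear_subspace A ->
  (forall i w, w =1 (fun n => (n == i)%:R) -> A w) -> closure A = setT.
Proof.
move=> [A0 Alin] Ae; apply/seteqP; split=> // w _.
have trunc N : exists2 t, A t & t =1 (fun n => if (n < N)%N then w n else 0).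
  elim: N => [|N [t At tE]]; first by exists 0.
  have [|b bE] := @c0_exists (fun n => (n == N)%:R).
    apply: (@eventually_zero_cvg _ N.+1) => n Nn.
    by rewrite gtn_eqF.
  exists (w N *: b + t); first by apply: Alin => //; exact: Ae bE.
  move=> n; rewrite c0_linE bE tE ltnS.
  case: ltngtP => [_|_|->]; first by rewrite mulr0 add0r.
    by rewrite mulr0 addr0.
  by rewrite mulr1 addr0.
move=> B /nbhs_ballP[r /= r0 rB].
have r20 : 0 < r / 2 by rewrite divr_gt0.
have /cvgr0Pnorm_lt/(_ _ r20)[N _ HN] := c0_cvg w.
have [t At tE] := trunc N; exists t; split=> //; apply: rB.
rewrite -ball_normE /=; apply: (@le_lt_trans _ _ (r / 2)); last lra.
apply: c0_norm_le => n; rewrite c0_subE tE.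
have [nN|Nn] := ltnP n N; first by rewrite subrr normr0 ltW.
by rewrite subr0 ltW//; exact: HN.
Qed.

End C0Facts.

(** Continuity of the inverse at 0 is enough: rescaling turns it into a lower
   bound for f. *)
Lemma isomorphism_bounds (R : realType) (X W : normedModType R) (Z : set X)
    (f : {linear W -> X}) (g : X -> W) :
  continuous f -> {within Z, continuous g} -> cancel f g -> range f = Z ->
  exists2 K, 0 <= K & forall w, `|f w| <= K * `|w| /\ `|w| <= K * `|f w|.
Proof.
move=> fcont gcont fK fZ.
have [M M0 fM] : exists2 M, 0 <= M & forall w, `|f w| <= M * `|w|.
  have /linear_bounded_continuous/linear_boundedP fb := fcont.
  have [M [fM M0]] := filter_ex (filterI fb (nbhs_pinfty_ge (num_real (0 : R)))).
  by exists M.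
have [m m0 gm] : exists2 m, 0 <= m & forall w, `|w| <= m * `|f w|.
  have g0 : g 0 = 0 by rewrite -(linear0 f) fK.
  have Z0 : Z 0 by rewrite -fZ; exists 0; rewrite ?linear0.
  have /subspace_continuousP/(_ 0 Z0)/cvgrPdist_lt/(_ 1 ltr01) := gcont.
  rewrite [from_subspace Z g 0]g0 => /nbhs_ballP[r /= r0 rg].
  have small w : `|f w| < r -> `|w| < 1.
    move=> fw; have : ball 0 r (f w) by rewrite -ball_normE/= sub0r normrN.
    move=> /rg; rewrite sub0r normrN [from_subspace Z g _]fK; apply.
    by rewrite -fZ; exists w.
  exists (2 / r) => [|w]; first by rewrite divr_ge0// ltW.
  have [fw0|fw0] := eqVneq (f w) 0.
    by rewrite -[w in `|w|]fK fw0 g0 !normr0 mulr0.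
  have nfw : 0 < `|f w| by rewrite normr_gt0.
  pose t := r / 2 / `|f w|; have t0 : 0 < t by rewrite !divr_gt0.
  have := small (t *: w).
  rewrite linearZ/= [`|t *: f w|]normrZ [`|t *: w|]normrZ (gtr0_norm t0).
  rewrite /t divfK ?gt_eqF// ltr_pdivrMr// ltr_pMr// ltr1n => /(_ isT)/ltW.
  rewrite -ler_pdivlMl// mulr1 => /le_trans; apply.
  by rewrite le_eqVlt; apply/orP; left; apply/eqP; field; rewrite !gt_eqF.
exists (Num.max M m); first by rewrite le_max M0.
move=> w; split.
  by apply: (le_trans (fM w)); rewrite ler_wpM2r// le_max lexx.
by apply: (le_trans (gm w)); rewrite ler_wpM2r// le_max lexx orbT.
Qed.

Theorem theorem6p4 (R : realType) (X : completeNormedModType R) (hX : PO_fd X)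
    (Z : set X) (Zlin : linear_subspace Z) (Zclosed : closed Z)
    (Zc0 : isomorphic_to Z (c0 R)) :
  complemented Z.
Proof.
have [f [g [fcont gcont fK fZ]]] := Zc0.
have [K K0 fb] := isomorphism_bounds fcont gcont fK fZ.
have /choice[coord hcoord] n : exists p, bounded_functional K p /\
    forall w, p (f w) = w n.
  pose G := [set q | exists w : c0 R, q = (f w, w n)].
  have [|p hp pG] := @hahn_banach R X K G K0.
    split=> [a _ _ _ _ [w [-> ->]] [w' [-> ->]]|_ _ [w [-> ->]]].
      by exists (a *: w + w'); rewrite linearP.
    by have [_] := fb w; apply: le_trans; exact: c0_norm_ge.
  by exists p; split=> // w; apply: pG; exists w.
have /choice[unitv unitvE] i : exists w : c0 R, w =1 (fun n => (n == i)%:R).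
  apply: c0_exists; apply: (@eventually_zero_cvg _ _ i.+1) => n ni.
  by rewrite gtn_eqF.
have [|n|z [i _ <-]|phi [hphi phi0 phi_coord]] :=
  @PO_fd_c0_valued_extension R X (range (f \o unitv)) K coord hX _ K0.
- exact: (sub_countable (card_image_le _ _) (countableP _)).
- by have [] := hcoord n.
- have -> : (fun n => coord n ((f \o unitv) i)) = unitv i.
    by apply/funext => n; have [_ ->] := hcoord n.
  exact: c0_cvg.
have /choice[Phi PhiE] x : exists w : c0 R, w =1 (fun n => phi n x).
  exact: c0_exists.
have [P PE] : exists P : {linear X -> X}, P =1 f \o Phi.
  apply: linear_pack => a x y /=; rewrite -linearP; congr (f _).
  apply: c0_eq => n; rewrite c0_linE !PhiE.
  exact: bfun_lin (hphi n).
have Phif w : Phi (f w) = w.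
  apply: c0_eq => n; rewrite PhiE.
  pose A := [set w : c0 R | phi n (f w) = w n].
  have Aw : closure A w.
    rewrite (@c0_closure_span _ A)//.
      split=> [|a x y /= xA yA]; first by rewrite /A/= linear0 (bfun0 (hphi n)).
      rewrite /A/= linearP (bfun_lin _ _ _ (hphi n)) xA yA //.
    move=> i w' w'E; have -> : w' = unitv i by apply: c0_eq => m; rewrite unitvE.
    rewrite /A/= phi_coord; last by exists i.
    by have [_ ->] := hcoord n.
  pose C := (K + K) * K + 1.
  have C0 : 0 <= C by rewrite addr_ge0// mulr_ge0// addr_ge0.
  have h1 : bounded_functional C (fun w => phi n (f w)).
    split=> [a x y|x]; first by rewrite linearP (bfun_lin _ _ _ (hphi n)).
    rewrite (le_trans (bfun_le _ (hphi n)))//.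
    apply: (@le_trans _ _ ((K + K) * (K * `|x|))).
      by rewrite ler_wpM2l ?addr_ge0//; have [] := fb x.
    by rewrite mulrA ler_wpM2r// lerDl.
  have h2 : bounded_functional C (fun w : c0 R => w n).
    have [l b] := c0_coord_bfun R n; split=> // x.
    by rewrite (le_trans (b x))// ler_wpM2r// lerDr mulr_ge0// addr_ge0.
  exact: (bfun_eq_closure (A := A) C0 h1 h2).
exists P; split.
- exists (K * (K + K)) => x; rewrite PE /=.
  have [fPhi _] := fb (Phi x); apply: (le_trans fPhi).
  rewrite -mulrA ler_wpM2l//; apply: c0_norm_le => n; rewrite PhiE.
  exact: bfun_le (hphi n).
- by move=> x; rewrite !PE /= Phif.
rewrite -fZ; apply/seteqP; split=> _ [x _ <-]; first by exists (Phi x); rewrite ?PE.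
by exists (f x) => //; rewrite PE /= Phif.
Qed.
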